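(* Let $\mathcal{V}^e$ be an extended KS set in $\mathbb{C}^d$ with orthogonality graph $G^e$ (an extended KS graph), and consider the vertex equality problem based on $G^e$ under the clique-oblivious conditions, with figure of merit $$S^{(2)}=\sum_{x}t_x\,p(0|x,x)+\sum_{x}\sum_{y\in N_x}t_x\,p(1|x,y),\qquad t_x=\frac{c_x}{N},$$ (notation in the context). Then quantum communication outperforms classical communication: the optimal value $S^{(2)}_c$ of $S^{(2)}$ over classical clique-oblivious strategies (with messages of arbitrary dimension) is strictly less than one, whereas the value $S^{(2)}=1$ is achieved by a quantum clique-oblivious strategy.
   Context: KS (Kochen–Specker) set in $\mathbb{C}^d$: a finite set of rank-one projectors (equivalently, of unit vectors up to phase) on $\mathbb{C}^d$ for which there is no assignment of values $0$ or $1$ to its elements such that no two orthogonal vectors are both assigned $1$ and exactly one vector in each orthonormal basis contained in the set is assigned $1$. Extended KS set: a finite set of rank-one projectors on $\mathbb{C}^d$ obtained from a KS set by adding (possibly zero) further rank-one projectors so that every element of the resulting set belongs to at least one orthonormal basis of $\mathbb{C}^d$ contained in the set. Orthogonality graph $G^e$: vertices $\{1,\dots,|G^e|\}$ correspond to the projectors of the extended set; two vertices are adjacent iff the projectors are orthogonal. $N_x$ is the set of vertices adjacent to $x$. Let $\Omega_1,\dots,\Omega_{n_w}$ be all the $d$-cliques (cliques with $d$ vertices) of $G^e$; every vertex lies in at least one of them. Let $m_x$ be the number of $d$-cliques containing $x$, $c_x=m_x/(|N_x|+1)$, and $N=\sum_{w=1}^{n_w}|\Omega_w|$. Vertex equality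 problem: Alice receives $x$, Bob receives $y$, both from the vertex set; Alice sends a system to Bob, who outputs $z\in\{0,1\}$; the correct answer is $z=0$ if $y=x$ and $z=1$ if $y\in N_x$ (other pairs do not count). Classical clique-oblivious strategy: an arbitrary positive integer $L$, conditional probabilities $p_e(\tau|x)$, $\tau\in\{1,\dots,L\}$, $\sum_\tau p_e(\tau|x)=1$, and $p_d(z|y,\tau)$ with $p_d(0|y,\tau)+p_d(1|y,\tau)=1$, such that for each $\tau$ the quantity $\frac{1}{|\Omega_w|}\sum_{x\in\Omega_w}p_e(\tau|x)$ is the same for all $w\in\{1,\dots,n_w\}$. Observed probabilities: $p(z|x,y)=\sum_\tau p_e(\tau|x)p_d(z|y,\tau)$. $S^{(2)}_c$ is the supremum of $S^{(2)}$ over all $L$ and all such strategies. Quantum clique-oblivious strategy: density operators $\rho_x$ on some Hilbert space such that $\frac{1}{|\Omega_w|}\sum_{x\in\Omega_w}\rho_x$ is the same for all $w$, and two-outcome measurements $\{M^0_y,M^1_y\}$ (positive semidefinite, $M^0_y+M^1_y=\mathbb{1}$). Observed probabilities: $p(z|x,y)=\mathrm{Tr}(\rho_xM^z_y)$. *)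

(* Defs.v *)
From HB Require Import structures.
From mathcomp Require Import all_boot all_order all_algebra.
From mathcomp Require Import finmap complex.
From mathcomp Require Import classical_sets reals constructive_ereal ereal.

Set Implicit Arguments.
Unset Strict Implicit.
Unset Printing Implicit Defensive.

Import Order.TTheory GRing.Theory Num.Theory.
Local Open Scope ring_scope.
Local Open Scope sesquilinear_scope.

Section Projectors.
Variables (R : realType) (d : nat).
Implicit Types (P : 'M[R[i]]_d) (V : {fset 'M[R[i]]_d}).

Definition rank_one_projector P : Prop :=
  [/\ P *m P = P, P ^t* = P & \rank P = 1%N].

Definition ketbra (v : 'cV[R[i]]_d) : 'M[R[i]]_d := v *m v ^t*.

(* d orthonormal vectors of C^d automatically form a basis. *)
Definition orthonormal_basis (v : 'I_d -> 'cV[R[i]]_d) : Prop :=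
  forall i j, (v i) ^t* *m v j = (i == j)%:R%:M.

Definition basis_in V (v : 'I_d -> 'cV[R[i]]_d) : Prop :=
  orthonormal_basis v /\ forall i, ketbra (v i) \in V.

(* Only the values of f on V matter.  The projectors ketbra (v i) of an
   orthonormal basis are distinct, so counting indices counts elements. *)
Definition KS_assignment V (f : 'M[R[i]]_d -> bool) : Prop :=
  (forall P Q, P \in V -> Q \in V -> P *m Q = 0 -> ~~ (f P && f Q)) /\
  (forall v, basis_in V v -> exists! i, f (ketbra (v i))).

Definition KS_set V : Prop :=
  (forall P, P \in V -> rank_one_projector P) /\
  ~ (exists f, KS_assignment V f).

Definition extended_KS_set V : Prop :=
  exists K : {fset 'M[R[i]]_d},
    [/\ KS_set K,
        {subset K <= V},
        (forall P, P \in V -> rank_one_projector P) &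
        (forall P, P \in V ->
           exists v, basis_in V v /\ exists i, P = ketbra (v i))].

Definition orth_graph V : rel V := fun x y => val x *m val y == 0.

End Projectors.

(* T is the vertex set and e the adjacency relation of the graph. *)
Section VertexEquality.
Variables (R : realType) (T : finType) (e : rel T) (d : nat).

Definition neighbours (x : T) : {set T} := [set y | e x y].

Definition cliques : {set {set T}} :=
  [set W : {set T} | (#|W| == d) &&
    [forall x in W, forall y in W, (x != y) ==> e x y]].

Definition clique_count (x : T) : nat := #|[set W in cliques | x \in W]|.

Definition c_coef (x : T) : R :=
  (clique_count x)%:R / (#|neighbours x| + 1)%:R.

Definition N_norm : nat := (\sum_(W in cliques) #|W|)%N.

Definition t_coef (x : T) : R := c_coef x / N_norm%:R.

(* p x y z stands for p(z|x,y); the outcomes 0 and 1 are false and true. *)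
Definition S2 (p : T -> T -> bool -> R) : R :=
  \sum_x t_coef x * p x x false +
  \sum_x \sum_(y in neighbours x) t_coef x * p x y true.

(* pe x tau stands for p_e(tau|x), and pd y tau z for p_d(z|y,tau). *)
Definition classical_oblivious (L : nat)
    (pe : T -> 'I_L -> R) (pd : T -> 'I_L -> bool -> R) : Prop :=
  [/\ (forall x tau, 0 <= pe x tau) /\ (forall x, \sum_tau pe x tau = 1),
      (forall y tau z, 0 <= pd y tau z),
      (forall y tau, pd y tau false + pd y tau true = 1) &
      (forall tau (W W' : {set T}), W \in cliques -> W' \in cliques ->
         #|W|%:R^-1 * (\sum_(x in W) pe x tau) =
         #|W'|%:R^-1 * (\sum_(x in W') pe x tau))].

Definition classical_prob (L : nat)
    (pe : T -> 'I_L -> R) (pd : T -> 'I_L -> bool -> R)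
    (x y : T) (z : bool) : R :=
  \sum_tau pe x tau * pd y tau z.

(* The supremum is taken in the extended reals, so it needs no a priori
   boundedness. *)
Definition S2_classical : \bar R :=
  ereal_sup (fun s : \bar R =>
    exists (L : nat) (pe : T -> 'I_L -> R) (pd : T -> 'I_L -> bool -> R),
      [/\ (0 < L)%N, classical_oblivious pe pd &
          s = (S2 (classical_prob pe pd))%:E]).

(* The order of R[i] makes "0 <= z" mean that z is real and nonnegative. *)
Definition psdmx n (A : 'M[R[i]]_n) : Prop :=
  A ^t* = A /\ forall v : 'cV[R[i]]_n, 0 <= (v ^t* *m A *m v) ord0 ord0.

Definition density n (rho : 'M[R[i]]_n) : Prop := psdmx rho /\ \tr rho = 1.

Definition quantum_oblivious n
    (rho : T -> 'M[R[i]]_n) (M : T -> bool -> 'M[R[i]]_n) : Prop :=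
  [/\ (forall x, density (rho x)),
      (forall y z, psdmx (M y z)),
      (forall y, M y false + M y true = 1%:M) &
      (forall W W' : {set T}, W \in cliques -> W' \in cliques ->
         #|W|%:R^-1 *: (\sum_(x in W) rho x) =
         #|W'|%:R^-1 *: (\sum_(x in W') rho x))].

(* The trace is real for positive semidefinite arguments; Re only casts it
   from R[i] to R. *)
Definition quantum_prob n
    (rho : T -> 'M[R[i]]_n) (M : T -> bool -> 'M[R[i]]_n)
    (x y : T) (z : bool) : R :=
  complex.Re (\tr (rho x *m M y z)).

End VertexEquality.

(* Main.v *)
(** Fix a message tau of a classical strategy and let q be the average of
    p_e(tau|x) over a clique, which by obliviousness does not depend on the
    clique.  The set A of vertices with p_e(tau|x) >= q meets every d-clique; if
    it contained no edge, its indicator would be a Kochen-Specker assignment.  So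
    A contains adjacent vertices x and y, and whatever Bob decodes from tau when
    his input is y, he errs on (y,y) or on (x,y): the loss due to tau is at least
    q times a lower bound t of all the t_x.  The averages q add up to 1 over the
    messages, so the classical value is at most 1 - t, uniformly in L.

    The quantum strategy sends the projector x itself and measures y against its
    complement; it is oblivious because the projectors of a d-clique add up to
    the identity. *)

Require Import Defs.
From HB Require Import structures.
From mathcomp Require Import all_boot all_order all_algebra.
From mathcomp Require Import finmap complex.
From mathcomp Require Import classical_sets reals constructive_ereal ereal.

Set Implicit Arguments.
Unset Strict Implicit.
Unset Printing Implicit Defensive.

Import Order.TTheory GRing.Theory Num.Theory.
Local Open Scope ring_scope.
Local Open Scope sesquilinear_scope.

(** * Vertex equality on a finite graph covered by its [d]-cliques *)

Section VertexEqualityTheory.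
Variables (R : realType) (T : finType) (e : rel T) (d : nat).
Hypothesis d_gt0 : (0 < d)%N.
Hypothesis clique_cover : forall x : T, exists2 W, W \in cliques e d & x \in W.
Implicit Types (p : T -> T -> bool -> R) (W : {set T}).

(** [D%:R^-1] bounds every weight from below: a vertex lies in at least one clique and has at most
    [#|T|] neighbours. *)
Let D := (#|T|.+1 * N_norm e d)%N.

Lemma card_clique W : W \in cliques e d -> #|W| = d.
Proof. by rewrite inE => /andP[/eqP]. Qed.

Lemma clique_count_gt0 x : (0 < clique_count e d x)%N.
Proof.
by have [W eW xW] := clique_cover x; apply/card_gt0P; exists W; rewrite inE eW.
Qed.

(** Double counting of the pairs formed by a clique and one of its vertices. *)
Lemma sum_clique_count : (\sum_x clique_count e d x = N_norm e d)%N.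
Proof.
rewrite /N_norm; under eq_bigr do rewrite /clique_count -sum1_card.
under [RHS]eq_bigr do rewrite -sum1_card.
rewrite (exchange_big_dep (mem (cliques e d))) /=; last first.
  by move=> x W _; rewrite inE => /andP[].
apply: eq_bigr => W eW; apply: eq_bigl => x.
by rewrite inE eW.
Qed.

Lemma N_norm_gt0 (x : T) : (0 < N_norm e d)%N.
Proof.
by rewrite -sum_clique_count (bigD1 x) //= ltn_addr // clique_count_gt0.
Qed.

Lemma t_coef_lb x : D%:R^-1 <= t_coef R e d x.
Proof.
have N0 := N_norm_gt0 x; have m0 := clique_count_gt0 x.
rewrite /t_coef /c_coef -mulrA -invfM -natrM ler_pdivlMr ?ltr0n ?muln_gt0 ?addn1 //.
rewrite mulrC ler_pdivrMr ?ltr0n ?muln_gt0 // -natrM ler_nat.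
rewrite (leq_trans (n := D)) ?leq_pmull //.
by rewrite leq_mul2r ltnS max_card orbT.
Qed.

Lemma t_coef_ge0 x : 0 <= t_coef R e d x.
Proof. by apply: le_trans (t_coef_lb x); rewrite invr_ge0 ler0n. Qed.

(** The weight of [x] occurs once for the pair [(x, x)] and once per neighbour, which cancels the
    denominator of [c_coef]; the clique counts then add up to [N_norm]. The vertex [x0] ensures that
    [N_norm] is nonzero. *)
Lemma S2_total (x0 : T) p :
  (forall x, p x x false = 1) -> (forall x y, e x y -> p x y true = 1) ->
  S2 e d p = 1.
Proof.
move=> p0 p1; rewrite /S2 -big_split /=.
have N0 : (N_norm e d)%:R != 0 :> R by rewrite pnatr_eq0 -lt0n (N_norm_gt0 x0).
rewrite -[RHS](mulfV N0) -{1}sum_clique_count natr_sum mulr_suml.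
apply: eq_bigr => x _; rewrite p0 mulr1.
under eq_bigr => y; first by rewrite inE => exy; rewrite p1 // mulr1; over.
rewrite sumr_const -mulrS -[LHS]mulr_natr /t_coef /c_coef addn1 mulrAC divfK //.
Qed.

(** Since the weights total one, the figure of merit is one minus the weighted error. Upper bounds
    on success thus become lower bounds on error, which can be proved message by message. *)
Lemma S2_flip (x0 : T) p :
  (forall x y, p x y false + p x y true = 1) ->
  S2 e d p = 1 - S2 e d (fun x y z => p x y (~~ z)).
Proof.
move=> p1; apply/eqP; rewrite eq_sym subr_eq; apply/eqP.
rewrite -(@S2_total x0 (fun=> fun=> fun=> 1)) // /S2 addrACA.
congr (_ + _); rewrite -big_split; apply: eq_bigr => x _ /=.
  by rewrite -mulrDr p1.
by rewrite -big_split; apply: eq_bigr => y _ /=; rewrite -mulrDr addrC p1.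
Qed.

Section Oblivious.
Variables (L : nat) (pe : T -> 'I_L -> R) (pd : T -> 'I_L -> bool -> R).
Hypothesis obl : classical_oblivious e d pe pd.
Hypothesis no_indep : forall A : {set T},
  (forall W, W \in cliques e d -> exists2 x, x \in W & x \in A) ->
  exists x y, [/\ x \in A, y \in A & e x y].

Lemma S2_classical_prob_lb W (tau : 'I_L) : W \in cliques e d ->
  D%:R^-1 * (#|W|%:R^-1 * (\sum_(x in W) pe x tau)) <=
  S2 e d (fun x y z => pe x tau * pd y tau (~~ z)).
Proof.
move=> eW; have [[pe0 _] pd0 pd1 avg] := obl.
set q := (X in _ * X).
have q0 : 0 <= q by rewrite mulr_ge0 ?invr_ge0 ?ler0n ?sumr_ge0.
have [|x [y [/[!inE] xA yA exy]]] := no_indep (A := [set x | q <= pe x tau]).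
  move=> W' eW'; apply/exists_inP; apply: contraT; rewrite negb_exists_in.
  move=> /forall_inP noA.
  suff: q < q by rewrite ltxx.
  (* Obliviousness turns [q] into the average over [W'], whose entries would all be below [q].
     Strictness of the sum needs [W'] to be nonempty, hence [d] positive. *)
  rewrite {1}/q (avg _ _ _ eW eW') card_clique // ltr_pdivrMl ?ltr0n //.
  rewrite mulr_natl -(card_clique eW') -sumr_const.
  have /card_gt0P[w wW'] : (0 < #|W'|)%N by rewrite (card_clique eW').
  apply: ltr_sum => [|x xW']; first by apply/hasP; exists w => //; rewrite mem_index_enum.
  by have := noA x xW'; rewrite inE -ltNge.
have le_term z u b : q <= pe z tau ->
    D%:R^-1 * q * pd u tau b <= t_coef R e d z * (pe z tau * pd u tau b).
  move=> qz; rewrite mulrA ler_wpM2r //.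
  by rewrite ler_pM ?invr_ge0 ?ler0n ?t_coef_lb.
have ge0 z u b : 0 <= t_coef R e d z * (pe z tau * pd u tau b).
  by rewrite !mulr_ge0 ?t_coef_ge0.
(* Split Bob's answer on y: "1" is wrong for (y,y), "0" is wrong for (x,y). *)
rewrite -[leLHS]mulr1 -[X in _ * X <= _](pd1 y tau) addrC mulrDr /S2 /=.
apply: lerD.
  rewrite (bigD1 y) //=; apply: le_trans (le_term y y true yA) _.
  by rewrite lerDl sumr_ge0.
rewrite (bigD1 x) //= (bigD1 y) ?inE //=.
apply: le_trans (le_term x y false xA) _.
rewrite -addrA lerDl addr_ge0 ?sumr_ge0 // => z _.
by rewrite sumr_ge0.
Qed.

Lemma S2_classical_prob_le (x0 : T) :
  S2 e d (classical_prob pe pd) <= 1 - D%:R^-1.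
Proof.
have [[pe0 pe1] pd0 pd1 avg] := obl.
rewrite (S2_flip x0) => [|x y]; last first.
  rewrite -big_split -(pe1 x); apply: eq_bigr => tau _.
  by rewrite /= -mulrDr pd1 mulr1.
rewrite lerD2l lerN2.
have [W eW _] := clique_cover x0.
have -> : S2 e d (fun x y z => classical_prob pe pd x y (~~ z)) =
    \sum_tau S2 e d (fun x y z => pe x tau * pd y tau (~~ z)).
  rewrite /S2 big_split /=; congr (_ + _).
    by rewrite exchange_big; apply: eq_bigr => x _; rewrite /= mulr_sumr.
  rewrite exchange_big; apply: eq_bigr => x _ /=.
  by rewrite exchange_big; apply: eq_bigr => y _; rewrite /= mulr_sumr.
(* Using the same clique [W] for all messages, the averages sum to one because each [pe x] does;
   this removes any dependence on [L]. *)
apply: le_trans (ler_sum _ (fun tau _ => S2_classical_prob_lb tau eW)).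
rewrite -!mulr_sumr exchange_big /=.
under eq_bigr do rewrite pe1.
rewrite sumr_const mulVf ?mulr1 // (card_clique eW) pnatr_eq0 -lt0n //.
Qed.

End Oblivious.

Lemma S2_classical_lt1 (x0 : T) :
  (forall A : {set T},
    (forall W, W \in cliques e d -> exists2 x, x \in W & x \in A) ->
    exists x y, [/\ x \in A, y \in A & e x y]) ->
  (S2_classical R e d < 1%:E)%E.
Proof.
(* A gap uniform over strategies keeps the supremum itself below one. *)
move=> no_indep; apply: (@le_lt_trans _ _ (1 - D%:R^-1)%:E).
  apply: ge_ereal_sup => _ [L [pe [pd [_ obl ->]]]].
  by rewrite lee_fin S2_classical_prob_le.
by rewrite lte_fin gtrBl invr_gt0 ltr0n muln_gt0 (N_norm_gt0 x0).
Qed.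

End VertexEqualityTheory.

(** * Orthogonal projections as Hermitian idempotent matrices *)

Section Projections.
Variable C : numClosedFieldType.

Lemma trmxCM m n k (A : 'M[C]_(m, n)) (B : 'M_(n, k)) :
  (A *m B) ^t* = B ^t* *m A ^t*.
Proof. by rewrite trmx_mul map_mxM. Qed.

Lemma mxtrace_trmxC_mul m n (A : 'M[C]_(m, n)) :
  \tr (A ^t* *m A) = \sum_i \sum_j `|A j i| ^+ 2.
Proof.
apply: eq_bigr => i _; rewrite mxE; apply: eq_bigr => j _.
by rewrite !mxE normCK mulrC.
Qed.

Lemma mxtrace_trmxC_mul_eq0 m n (A : 'M[C]_(m, n)) :
  \tr (A ^t* *m A) = 0 -> A = 0.
Proof.
rewrite mxtrace_trmxC_mul => /eqP.
rewrite psumr_eq0 => [/allP A0|i _]; last by apply: sumr_ge0 => j _; apply: exprn_ge0.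
apply/matrixP => j i; rewrite mxE; apply/eqP.
have := A0 i (mem_index_enum i); rewrite psumr_eq0 => [/allP|k _]; last exact: exprn_ge0.
by move=> /(_ j (mem_index_enum j)); rewrite sqrf_eq0 normr_eq0.
Qed.

Lemma hermitian_idem_trace_eq0 n (P : 'M[C]_n) :
  P *m P = P -> P ^t* = P -> \tr P = 0 -> P = 0.
Proof. by move=> PP Ph tP; apply: mxtrace_trmxC_mul_eq0; rewrite Ph PP. Qed.

Lemma hermitian_idem_compl n (P : 'M[C]_n) :
  P *m P = P -> P ^t* = P ->
  (1%:M - P) *m (1%:M - P) = 1%:M - P /\ (1%:M - P) ^t* = 1%:M - P.
Proof.
move=> PP Ph; split; first by rewrite mulmxBl mul1mx mulmxBr mulmx1 PP subrr subr0.
by rewrite linearB /= map_mxB Ph trmx1 map_mx1.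
Qed.

(** The sum [S] is itself a Hermitian idempotent, hence so is [1%:M - S], whose trace is
    [n - #|A| = 0]; a Hermitian idempotent of trace zero vanishes. *)
Lemma sum_projectors_eq1 (I : finType) n (A : {pred I}) (P : I -> 'M[C]_n) :
  #|A| = n ->
  (forall i, i \in A -> [/\ P i *m P i = P i, (P i) ^t* = P i & \tr (P i) = 1]) ->
  {in A &, forall i j, i != j -> P i *m P j = 0} ->
  \sum_(i in A) P i = 1%:M.
Proof.
move=> cA projP orthP; set S := \sum_(i in A) P i.
have SP i : i \in A -> S *m P i = P i.
  move=> iA; have [PP _ _] := projP i iA.
  rewrite /S mulmx_suml (bigD1 i) //= PP big1 ?addr0 // => j /andP[jA ji].
  exact: orthP.
have SS : S *m S = S by rewrite {2}/S mulmx_sumr; apply: eq_bigr => i /SP.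
have Sh : S ^t* = S.
  rewrite /S raddf_sum /= map_mx_sum; apply: eq_bigr => i /projP[] //.
have [QQ Qh] := hermitian_idem_compl SS Sh.
apply/esym/eqP; rewrite -subr_eq0; apply/eqP; apply: hermitian_idem_trace_eq0 => //.
rewrite mxtraceD mxtrace1 raddfN /S (raddf_sum (@mxtrace C n)) /=.
rewrite (eq_bigr (fun=> 1)) => [|i /projP[] //].
by rewrite sumr_const cA subrr.
Qed.

Lemma hermitian_idem_form_ge0 n (P : 'M[C]_n) (v : 'cV[C]_n) :
  P *m P = P -> P ^t* = P -> 0 <= (v ^t* *m P *m v) ord0 ord0.
Proof.
move=> PP Ph; rewrite -PP -{1}Ph mulmxA -trmxCM -mulmxA mxE sumr_ge0 // => i _.
by rewrite !mxE mulrC -normCK exprn_ge0.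
Qed.

End Projections.

(** * The orthogonality graph of an extended KS set *)

Section KochenSpecker.
Variables (R : realType) (d : nat) (V : {fset 'M[R[i]]_d}).
Hypothesis d_gt0 : (0 < d)%N.
Hypothesis hV : extended_KS_set V.

Lemma orthonormal_ketbra (v : 'I_d -> 'cV[R[i]]_d) i j :
  orthonormal_basis v ->
  ketbra (v i) *m ketbra (v j) = (i == j)%:R *: ketbra (v i).
Proof.
move=> ov; rewrite /ketbra mulmxA -(mulmxA (v i)) ov mul_mx_scalar -scalemxAl.
by case: eqP => [->|]; rewrite ?scale0r.
Qed.

Lemma mxtrace_ketbra (v : 'I_d -> 'cV[R[i]]_d) i :
  orthonormal_basis v -> \tr (ketbra (v i)) = 1.
Proof. by move=> ov; rewrite mxtrace_mulC ov eqxx mxtrace1. Qed.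

Lemma ketbra_neq0 (v : 'I_d -> 'cV[R[i]]_d) i :
  orthonormal_basis v -> ketbra (v i) != 0.
Proof.
move=> ov; apply/eqP => v0; have := mxtrace_ketbra i ov.
by rewrite v0 mxtrace0 => /esym/eqP; rewrite oner_eq0.
Qed.

Lemma basis_clique (v : 'I_d -> 'cV[R[i]]_d) : basis_in V v ->
  [set x : V | [exists i, val x == ketbra (v i)]] \in cliques (@orth_graph R d V) d.
Proof.
move=> [ov vV]; pose g i : V := [` vV i]%fset.
(* If two distinct indices gave the same projector, it would be idempotent and orthogonal to itself,
   hence zero, against its trace one. *)
have gI : injective g.
  move=> i j /(congr1 val) /= gij; apply/eqP; apply: contraT => ij.
  have := orthonormal_ketbra i j ov; rewrite -gij orthonormal_ketbra // eqxx.
  by rewrite (negPf ij) scale1r scale0r => /eqP; rewrite (negPf (ketbra_neq0 i ov)).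
have -> : [set x : V | [exists i, val x == ketbra (v i)]] = g @: [set: 'I_d].
  apply/setP => x; rewrite inE; apply/existsP/imsetP => [[i /eqP xi]|[i _ ->]].
    by exists i; [rewrite inE|apply: val_inj].
  by exists i.
rewrite inE card_imset // cardsT card_ord eqxx /=.
apply/forall_inP => _ /imsetP[i _ ->]; apply/forall_inP => _ /imsetP[j _ ->].
apply/implyP => gij; rewrite /orth_graph /= orthonormal_ketbra //.
by case: (eqVneq i j) gij => [->|_ _]; rewrite ?eqxx // scale0r.
Qed.

Lemma vertex_basis (x : V) :
  exists v, basis_in V v /\ exists i, val x = ketbra (v i).
Proof. by have [K [_ _ _ cov]] := hV; apply: cov; apply: valP. Qed.

Lemma vertex_clique (x : V) :
  exists2 W, W \in cliques (@orth_graph R d V) d & x \in W.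
Proof.
have [v [vV [i xi]]] := vertex_basis x; eexists; first exact: basis_clique vV.
by rewrite inE; apply/existsP; exists i; rewrite xi.
Qed.

Lemma vertex_projector (x : V) :
  [/\ val x *m val x = val x, (val x) ^t* = val x & \tr (val x) = 1].
Proof.
have [v [[ov _] [i xi]]] := vertex_basis x.
have [K [_ _ rk1 _]] := hV; have [PP Ph _] := rk1 _ (valP x).
by split => //; rewrite xi mxtrace_ketbra.
Qed.

Lemma sum_clique_projectors W : W \in cliques (@orth_graph R d V) d ->
  \sum_(x in W) val x = 1%:M.
Proof.
rewrite inE => /andP[/eqP cW /forall_inP adj].
apply: sum_projectors_eq1 cW _ _ => [x _|x y xW yW xy].
  exact: vertex_projector.
by apply/eqP; have /forall_inP/(_ y yW)/implyP/(_ xy) := adj x xW.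
Qed.

Lemma extended_KS_no_indep (A : {set V}) :
  (forall W, W \in cliques (@orth_graph R d V) d ->
     exists2 x, x \in W & x \in A) ->
  exists x y, [/\ x \in A, y \in A & orth_graph x y].
Proof.
move=> meets; have [K [[_ noKS] KV _ _]] := hV.
case: (boolP [exists x in A, exists y in A, orth_graph x y]).
  by case/exists_inP => x xA /exists_inP[y yA xy]; exists x, y.
(* Without an edge in [A], its indicator is an assignment on the original KS set [K]: a basis in [K]
   is also a clique of [V], so [A] meets it, and by independence only once. *)
move=> noadj; case: noKS; exists (fun P => [exists x in A, val x == P]).
have indep P Q : P *m Q = 0 ->
    ~~ ([exists x in A, val x == P] && [exists x in A, val x == Q]).
  move=> PQ0; apply: contra noadj => /andP[/exists_inP[x xA /eqP xP]].
  move=> /exists_inP[y yA /eqP yQ]; apply/exists_inP; exists x => //.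
  by apply/exists_inP; exists y => //; rewrite /orth_graph xP yQ PQ0.
split=> [P Q _ _|v [ov vK]]; first exact: indep.
have [|x] := meets _ (@basis_clique v _); first by split=> // i; apply: KV.
rewrite inE => /existsP[i /eqP xi] xA; exists i; split.
  by apply/exists_inP; exists x; rewrite ?xi.
move=> j vj; apply/eqP; apply: contraT => ij.
have /indep : ketbra (v i) *m ketbra (v j) = 0.
  by rewrite orthonormal_ketbra // (negPf ij) scale0r.
by rewrite vj andbT => /exists_inP[]; exists x; rewrite ?xi.
Qed.

(** For positive [d] an empty [K] contains no basis, so every assignment is vacuously valid. For
    [d = 0] the empty basis admits no chosen index, and the empty set would count as a KS set. *)
Lemma extended_KS_inhabited : exists x : V, True.
Proof.
have [K [[_ noKS] KV _ _]] := hV; case: (fset_0Vmem K) => [K0|[P PK]].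
  case: noKS; exists (fun=> true); split=> [P Q|v [_ /(_ (Ordinal d_gt0))]].
    by rewrite K0.
  by rewrite K0.
by exists [` KV _ PK]%fset.
Qed.

End KochenSpecker.

Theorem proposition3 (R : realType) (d : nat) (hd : (0 < d)%N)
    (V : {fset 'M[R[i]]_d}) (hV : extended_KS_set V) :
  (S2_classical R (@orth_graph R d V) d < 1%:E)%E /\
  exists (n : nat) (rho : V -> 'M[R[i]]_n) (M : V -> bool -> 'M[R[i]]_n),
    quantum_oblivious (@orth_graph R d V) d rho M /\
    S2 (@orth_graph R d V) d (quantum_prob rho M) = 1.
Proof.
have [x0 _] := extended_KS_inhabited hd hV.
have cover := vertex_clique hV.
split; first exact: S2_classical_lt1 hd cover x0 (extended_KS_no_indep hV).
have psd P : P *m P = P -> P ^t* = P -> @psdmx R d P.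
  by move=> PP Ph; split=> // v; apply: hermitian_idem_form_ge0.
exists d, (fun x => val x), (fun x z => if z then 1%:M - val x else val x).
split.
  split=> [x|x z|x|W W' eW eW'].
  - by have [PP Ph tP] := vertex_projector hV x; split=> //; apply: psd.
  - have [PP Ph _] := vertex_projector hV x.
    by case: z; apply: psd => //; have [] := hermitian_idem_compl PP Ph.
  - by rewrite addrC subrK.
  (* Every clique average is the maximally mixed state. *)
  - by rewrite !(sum_clique_projectors hV) // (card_clique eW) (card_clique eW').
apply: (S2_total cover x0) => [x|x y /eqP xy]; rewrite /quantum_prob.
  by have [-> _ ->] := vertex_projector hV x.
have [_ _ tP] := vertex_projector hV x.
by rewrite mulmxBr mulmx1 xy subr0 tP.
Qed.
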